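(* Let $(V,g)$ be a Euclidean real vector space of dimension $n$ and let $R$ be a symmetric $(2,2)$ double form on $V$ satisfying the first Bianchi identity. Then for every integer $k$ with $4\le 2k+2\le n$, $$h_{2k+2}(R)=\langle N_{2k}(R),R\rangle,$$ where $h_{2k+2}(R)=\frac{1}{(n-2k-2)!}*\bigl(g^{n-2k-2}R^{k+1}\bigr)$ and $N_{2k}(R)=*\frac{g^{n-2k-2}R^k}{(n-2k-2)!}$.
   Context: Let $(V,g)$ be a Euclidean real vector space of dimension $n$. A $(p,q)$ double form is an element of $\mathcal D^{p,q}=\Lambda^pV^*\otimes\Lambda^qV^*$, identified with a bilinear form $\Lambda^pV\times\Lambda^qV\to\mathbb R$. Exterior product: $(\theta_1\otimes\theta_2)(\theta_3\otimes\theta_4)=(\theta_1\wedge\theta_3)\otimes(\theta_2\wedge\theta_4)$, extended bilinearly; powers are taken for this product, with zeroth power $1$; $g$ is regarded as a $(1,1)$ double form. Inner product: $\langle\theta_1\otimes\theta_2,\theta_3\otimes\theta_4\rangle=\langle\theta_1,\theta_3\rangle\langle\theta_2,\theta_4\rangle$, using the inner product on $\Lambda^pV^*$ for which $e^{i_1}\wedge\dots\wedge e^{i_p}$, $i_1<\dots<i_p$, are orthonormal when $(e^i)$ is dual to an orthonormal basis. Double Hodge star: for a $(p,p)$ double form $\omega$, $*\omega$ is the $(n-p,n-p)$ double form $*\omega(u,v)=\omega( *u,*v)$, with $*$ on the right the usual Hodge star $\Lambda^{n-p}V\to\Lambda^{p}V$ for some chosen orientation (the result does not depend on it); a $(0,0)$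 double form is a scalar. A $(2,2)$ double form $R$ is symmetric if $R(u,v)=R(v,u)$ for $u,v\in\Lambda^2V$, and satisfies the first Bianchi identity if $\sum_{j=1}^{3}(-1)^jR(x_1\wedge\dots\widehat{x_j}\dots\wedge x_3,\;x_j\wedge y)=0$ for all $x_1,x_2,x_3,y\in V$. *)

(* Defs.v *)
From HB Require Import structures.
From mathcomp Require Import all_boot all_order all_algebra.
From mathcomp Require Import reals.
Set Implicit Arguments.
Unset Strict Implicit.
Unset Printing Implicit Defensive.
Import Order.TTheory GRing.Theory Num.Theory.
Local Open Scope ring_scope.

(* A p-covector, i.e. an element of the p-th exterior power of V^*, is
   represented as the alternating multilinear map (x_1, .., x_p) |-> f xs on
   sequences xs = [:: x_1; ..; x_p], extended by 0 to sequences of any other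
   length.  All degrees thus live in one type, the graded exterior algebra, and
   products such as g^(n-2k-2) R^(k+1) need no casts between degrees.
   A (p, q) double form is likewise w : seq V -> seq V -> R, where w xs ys is
   the value of the bilinear form at (x_1 /\ .. /\ x_p, y_1 /\ .. /\ y_q). *)

Section DoubleForms.
Variables (R : realType) (V : vectType R).

Definition covector (p : nat) (f : seq V -> R) : Prop :=
  [/\ forall xs, size xs != p -> f xs = 0,
      forall s t (a : R) (x y : V),
        f (s ++ (a *: x + y) :: t) = a * f (s ++ x :: t) + f (s ++ y :: t)
    & forall xs, ~~ uniq xs -> f xs = 0].

Definition dform := seq V -> seq V -> R.

Definition double_form (p q : nat) (w : dform) : Prop :=
  (forall ys, covector p (w^~ ys)) /\ (forall xs, covector q (w xs)).

Definition tens (f1 f2 : seq V -> R) : dform := fun xs ys => f1 xs * f2 ys.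

(* The subsequence (x_i)_(i in I), in increasing order of the indices. *)
Definition pick_seq (xs : seq V) (m : nat) (I : {set 'I_m}) : seq V :=
  [seq nth 0 xs (val i) | i in I].

(* The signature of the permutation of 0, .., m-1 that lists I increasingly and
   then the complement of I increasingly: the parity of its inversions. *)
Definition shuffle_sign (m : nat) (I : {set 'I_m}) : R :=
  (-1) ^+ #|[set ij : 'I_m * 'I_m |
              [&& ij.1 \in I, ij.2 \notin I & (ij.2 < ij.1)%N]]|.

(* Exterior product of alternating maps, as a sum over shuffles. *)
Definition wedge (f1 f2 : seq V -> R) (xs : seq V) : R :=
  \sum_(I : {set 'I_(size xs)})
     shuffle_sign I * (f1 (pick_seq xs I) * f2 (pick_seq xs (~: I))).

(* The bilinear extension of
   (f1 (x) f2) (f3 (x) f4) = (f1 /\ f3) (x) (f2 /\ f4); see dfmul_tens. *)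
Definition dfmul (w1 w2 : dform) : dform := fun xs ys =>
  \sum_(I : {set 'I_(size xs)}) \sum_(J : {set 'I_(size ys)})
     shuffle_sign I * shuffle_sign J *
     (w1 (pick_seq xs I) (pick_seq ys J) *
      w2 (pick_seq xs (~: I)) (pick_seq ys (~: J))).

Lemma dfmul_tens (f1 f2 f3 f4 : seq V -> R) xs ys :
  dfmul (tens f1 f2) (tens f3 f4) xs ys = tens (wedge f1 f3) (wedge f2 f4) xs ys.
Proof.
rewrite /dfmul /tens /wedge big_distrlr /=.
apply: eq_bigr => I _; apply: eq_bigr => J _.
by rewrite [RHS]mulrACA; congr (_ * _); exact: mulrACA.
Qed.

Definition dfone : dform := fun xs ys => (nilp xs && nilp ys)%:R.

Definition dfpow (w : dform) (k : nat) : dform :=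
  iter k (fun u => dfmul u w) dfone.

Definition dfscale (a : R) (w : dform) : dform := fun xs ys => a * w xs ys.

Definition dfsym (w : dform) : Prop := forall xs ys, w xs ys = w ys xs.

(* The index j : 'I_3 starts at 0, whence the exponent j.+1. *)
Definition first_bianchi (w : dform) : Prop :=
  forall (x : 'I_3 -> V) (y : V),
    \sum_(j < 3) (-1) ^+ j.+1 * w [seq x i | i in predC1 j] [:: x j; y] = 0.

Variable g : {dot V for idfun}.

Definition gform : dform := fun xs ys =>
  match xs, ys with [:: x], [:: y] => g x y | _, _ => 0 end.

Section OrthonormalBasis.
Variables (n : nat) (e : n.-tuple V).

Definition orthonormal_basis : Prop :=
  basis_of fullv e /\ forall i j, g (tnth e i) (tnth e j) = (i == j)%:R.

(* e_I is pick_seq e I.  A covector f has coordinates f e_I in the basis dual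
   to the e_I, so these are the inner products in which the exterior products
   of the dual basis of e are orthonormal. *)
Definition covdot (f1 f2 : seq V -> R) : R :=
  \sum_(I : {set 'I_n}) f1 (pick_seq e I) * f2 (pick_seq e I).

Definition dfdot (w1 w2 : dform) : R :=
  \sum_(I : {set 'I_n}) \sum_(J : {set 'I_n})
     w1 (pick_seq e I) (pick_seq e J) * w2 (pick_seq e I) (pick_seq e J).

Lemma dfdot_tens (f1 f2 f3 f4 : seq V -> R) :
  dfdot (tens f1 f2) (tens f3 f4) = covdot f1 f3 * covdot f2 f4.
Proof.
rewrite /dfdot /tens /covdot big_distrlr /=.
by apply: eq_bigr => I _; apply: eq_bigr => J _; rewrite mulrACA.
Qed.

(* The coordinate < e_I, x_1 /\ .. /\ x_q > of the multivector of xs on e_I. *)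
Definition mvcoord (I : {set 'I_n}) (xs : seq V) : R :=
  if size xs == #|I| then
    \det (\matrix_(i < #|I|, j < #|I|) g (tnth e (enum_val i)) (nth 0 xs j))
  else 0.

(* For the orientation of e, the Hodge star on multivectors is the linear map
   sending e_I to shuffle_sign I e_(~: I), so that e_I wedged with its star is
   e_1 /\ .. /\ e_n; the sum below is w (star u, star v) for u, v the
   multivectors of xs and ys, both expanded in the orthonormal basis (e_I). *)
Definition dfstar (w : dform) : dform := fun xs ys =>
  \sum_(I : {set 'I_n}) \sum_(J : {set 'I_n})
     mvcoord I xs * shuffle_sign I * (mvcoord J ys * shuffle_sign J) *
     w (pick_seq e (~: I)) (pick_seq e (~: J)).

(* The value of a (0, 0) double form w as a scalar is w [::] [::]. *)
Definition h2k2 (k : nat) (w : dform) : R :=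
  ((n - 2 * k - 2)`!%:R)^-1 *
    dfstar (dfmul (dfpow gform (n - 2 * k - 2)) (dfpow w k.+1)) [::] [::].

Definition N2k (k : nat) (w : dform) : dform :=
  dfstar (dfscale ((n - 2 * k - 2)`!%:R)^-1
            (dfmul (dfpow gform (n - 2 * k - 2)) (dfpow w k))).

End OrthonormalBasis.
End DoubleForms.

(* Main.v *)
(** Evaluated on [(e_1, .., e_n)], the product [A w] of an [(n-2, n-2)] form
    with a [(2, 2)] form is the sum of [A e_I e_J * w e_(~: I) e_(~: J)] with
    shuffle signs, while [<*A, w>] is the same sum with [I, J] replaced by their
    complements, which changes both signs by the same factor.  The theorem is
    thus [<*A, w> = *(A w)] for [A = g^(n-2k-2) w^k / (n-2k-2)!], together with
    the associativity of the product. *)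

Require Import Defs.
From mathcomp Require Import all_boot all_order all_algebra.
From mathcomp Require Import reals.
Local Open Scope ring_scope.
Import GRing.Theory.
Set Implicit Arguments.
Unset Strict Implicit.
Unset Printing Implicit Defensive.

(** * Signed splittings of a sequence into two blocks *)

Section Unshuffle.
Variables (R : comNzRingType) (T : Type).
Implicit Types (F : seq T -> seq T -> R) (xs : seq T).

(* The signed sum of [F a b] over all ways of splitting a sequence into
   complementary subsequences [a] and [b]; moving [x] to the front of [b]
   makes it jump over the elements of [a]. *)
Fixpoint unshuffle F xs : R :=
  if xs is x :: xs' then
    unshuffle (fun a b => F (x :: a) b) xs' +
    unshuffle (fun a b => (-1) ^+ size a * F a (x :: b)) xs'
  else F [::] [::].

Lemma eq_unshuffle F G xs :
  (forall a b, (size a + size b)%N = size xs -> F a b = G a b) ->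
  unshuffle F xs = unshuffle G xs.
Proof.
elim: xs F G => [|x xs IH] F G eqFG /=; first exact: eqFG.
congr (_ + _); apply: IH => a b sab; first by rewrite eqFG //= addSn sab.
by rewrite eqFG //= addnS sab.
Qed.

Lemma unshuffleD F G xs :
  unshuffle (fun a b => F a b + G a b) xs = unshuffle F xs + unshuffle G xs.
Proof.
elim: xs F G => [|x xs IH] F G //=; rewrite IH addrACA; congr (_ + _).
by rewrite -IH; apply: eq_unshuffle => a b _; rewrite mulrDr.
Qed.

Lemma unshuffleZ c F xs :
  unshuffle (fun a b => c * F a b) xs = c * unshuffle F xs.
Proof.
elim: xs F => [|x xs IH] F //=; rewrite mulrDr IH; congr (_ + _).
by rewrite -IH; apply: eq_unshuffle => a b _; rewrite mulrCA.
Qed.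

Lemma exchange_unshuffle (F : seq T -> seq T -> seq T -> seq T -> R) xs ys :
  unshuffle (fun a b => unshuffle (F a b) ys) xs =
  unshuffle (fun c d => unshuffle (fun a b => F a b c d) xs) ys.
Proof.
elim: xs F => [|x xs IH] F //=.
rewrite unshuffleD; congr (_ + _); first exact: IH.
by rewrite -IH; apply: eq_unshuffle => a b _; rewrite unshuffleZ.
Qed.

(** Both sides sum over splittings into three blocks. An element sent to the last block jumps over
    the first two, at once on the left and one after the other on the right, and the sign exponents
    add up. *)
Lemma unshuffle_coassoc (F : seq T -> seq T -> seq T -> R) xs :
  unshuffle (fun a b => unshuffle (fun c d => F c d b) a) xs =
  unshuffle (fun a b => unshuffle (F a) b) xs.
Proof.
elim: xs F => [|x xs IH] F //=.
rewrite !unshuffleD -addrA; congr (_ + _); first exact: IH.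
under [RHS]eq_unshuffle => a b _ do rewrite mulrDr -!unshuffleZ.
rewrite unshuffleD -!IH; congr (_ + _).
apply: eq_unshuffle => a b _; rewrite -unshuffleZ.
by apply: eq_unshuffle => c d <-; rewrite exprD mulrA.
Qed.

(** Exchanging adjacent blocks of lengths [p] and [q] takes [p * q] transpositions. *)
Lemma unshuffleC F xs :
  unshuffle F xs =
  unshuffle (fun a b => (-1) ^+ (size a * size b) * F b a) xs.
Proof.
elim: xs F => [|x xs IH] F /=; first by rewrite mul1r.
(* The head is in the second block on the left exactly when it is in the first on the right, so the
   summands match crosswise. *)
rewrite addrC; congr (_ + _); rewrite IH; apply: eq_unshuffle => a b _.
  by rewrite mulrA mulSn addnC exprD.
by rewrite mulrA mulnS exprD mulrA -expr2 sqrr_sign mul1r.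
Qed.

End Unshuffle.

(** * Sums over index sets as signed splittings *)

Section ShuffleSums.
Variables (R : realType) (V : vectType R).

(** Together with the bit [ord0 \in I] this determines [I], with inverse [cons_set]; sums over
    subsets can then follow the recursion of [unshuffle]. *)
Definition behead_set m (I : {set 'I_m.+1}) : {set 'I_m} := lift ord0 @^-1: I.

Definition cons_set m (p : bool * {set 'I_m}) : {set 'I_m.+1} :=
  [set i | if unlift ord0 i is Some j then j \in p.2 else p.1].

Lemma ord0_cons_set m (p : bool * {set 'I_m}) : (ord0 \in cons_set p) = p.1.
Proof. by rewrite inE unlift_none. Qed.

Lemma cons_setK m : cancel (@cons_set m)
  (fun I : {set 'I_m.+1} => (ord0 \in I, behead_set I)).
Proof.
move=> p; rewrite ord0_cons_set [RHS]surjective_pairing; congr (_, _).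
by apply/setP=> i; rewrite !inE liftK.
Qed.

Lemma behead_setK m :
  cancel (fun I : {set 'I_m.+1} => (ord0 \in I, behead_set I)) (@cons_set m).
Proof.
move=> I; apply/setP=> i; rewrite inE.
by case: unliftP => [j|] ->; rewrite // inE.
Qed.

Lemma pick_seq_cons m (x : V) xs (I : {set 'I_m.+1}) :
  pick_seq (x :: xs) I = nseq (ord0 \in I) x ++ pick_seq xs (behead_set I).
Proof.
rewrite /pick_seq /image_mem /enum_mem -!enumT !enum_ordSl /= filter_map.
have -> : [seq i <- enum 'I_m | preim (lift ord0) (mem I) i] =
          [seq i <- enum 'I_m | mem (behead_set I) i].
  by apply: eq_filter => i; rewrite /= !inE.
by case: ifP => _ /=; rewrite -map_comp.
Qed.

Lemma size_pick_seq m (xs : seq V) (I : {set 'I_m}) :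
  size (pick_seq xs I) = #|I|.
Proof. by rewrite size_map -cardE. Qed.

Lemma shuffle_signE m (I : {set 'I_m}) :
  shuffle_sign R I =
  (-1) ^+ (\sum_(i < m) \sum_(j < m) [&& i \in I, j \notin I & (j < i)%N])%N.
Proof.
rewrite /shuffle_sign -sum1dep_card big_mkcond pair_bigA /=.
by congr (_ ^+ _); apply: eq_bigr => ij _; case: ifP.
Qed.

(** Index 0 takes part in inversions only when it lies outside [I], and then with every element of
    [I]. *)
Lemma shuffle_sign_cons m (I : {set 'I_m.+1}) :
  shuffle_sign R I =
  (-1) ^+ ((ord0 \notin I) * #|behead_set I|) * shuffle_sign R (behead_set I).
Proof.
rewrite !shuffle_signE -exprD; congr (_ ^+ _).
rewrite big_ord_recl big1 ?add0n => [|j _]; last by rewrite ltn0 !andbF.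
under eq_bigr => i _ do rewrite big_ord_recl /=.
rewrite big_split /=; congr (_ + _)%N.
  rewrite -sum1_card big_distrr /= [RHS]big_mkcond /=; apply: eq_bigr => i _.
  by rewrite andbT !inE; case: (_ \in I); rewrite /= ?muln1.
by apply: eq_bigr => i _; apply: eq_bigr => j _; rewrite !inE.
Qed.

(** Whether index 0 lies in [I] is the first step of the recursion. The length is a separate [n] to
    cover sums over subsets of ['I_n] for an [n]-tuple. *)
Lemma sum_shuffle n (F : seq V -> seq V -> R) xs : size xs = n ->
  \sum_(I : {set 'I_n}) shuffle_sign R I * F (pick_seq xs I) (pick_seq xs (~: I))
  = unshuffle F xs.
Proof.
move=> <-; elim: xs F => [|x xs IH] F /=.
  have set_ord0 (I : {set 'I_0}) : I = set0 by apply/setP; case.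
  rewrite (big_pred1 set0) => [|I]; last by rewrite /= (set_ord0 I) eqxx.
  rewrite shuffle_signE big_ord0 mul1r.
  by congr F; apply: size0nil; rewrite size_pick_seq eq_card0 // => -[].
rewrite (reindex (@cons_set _)) /=; last first.
  by apply: onW_bij;
    exists (fun I : {set 'I_(size xs).+1} => (ord0 \in I, behead_set I));
    [exact: cons_setK | exact: behead_setK].
rewrite -(pair_bigA _ (fun b I => shuffle_sign R (cons_set (b, I)) *
  F (pick_seq (x :: xs) (cons_set (b, I)))
    (pick_seq (x :: xs) (~: cons_set (b, I))))) /=.
have beheadK b (I : {set 'I_(size xs)}) : behead_set (cons_set (b, I)) = I.
  by have [] := cons_setK (b, I).
rewrite big_bool; congr (_ + _); rewrite -IH; apply: eq_bigr => I _;
  rewrite shuffle_sign_cons !pick_seq_cons in_setC ord0_cons_set /=;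
  rewrite /behead_set preimsetC -/(behead_set _) beheadK.
  by rewrite mul0n mul1r.
by rewrite mul1n size_pick_seq mulrCA mulrA.
Qed.

Lemma sum2_shuffle n (F : seq V -> seq V -> seq V -> seq V -> R) xs ys :
    size xs = n -> size ys = n ->
  \sum_(I : {set 'I_n}) \sum_(J : {set 'I_n})
    shuffle_sign R I * shuffle_sign R J *
      F (pick_seq xs I) (pick_seq xs (~: I)) (pick_seq ys J) (pick_seq ys (~: J))
  = unshuffle (fun a b => unshuffle (F a b) ys) xs.
Proof.
move=> sx sy; rewrite -(sum_shuffle _ sx); apply: eq_bigr => I _.
rewrite -(sum_shuffle _ sy) mulr_sumr.
by apply: eq_bigr => J _; rewrite mulrA.
Qed.

End ShuffleSums.

(** * Associativity of the product of double forms *)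

Section DoubleFormProduct.
Variables (R : realType) (V : vectType R).
Implicit Types (A B C : dform V) (xs ys : seq V).

Lemma dfmulE A B xs ys :
  dfmul A B xs ys =
  unshuffle (fun a b => unshuffle (fun c d => A a c * B b d) ys) xs.
Proof.
rewrite /dfmul -(sum_shuffle _ erefl); apply: eq_bigr => I _.
rewrite -(sum_shuffle _ erefl) mulr_sumr.
by apply: eq_bigr => J _; rewrite -mulrA.
Qed.

Lemma dfmulA A B C xs ys :
  dfmul A (dfmul B C) xs ys = dfmul (dfmul A B) C xs ys.
Proof.
rewrite !dfmulE.
(* All splittings of [xs] are brought outside those of [ys], so that coassociativity can regroup
   them. *)
transitivity (unshuffle (fun a b => unshuffle (fun a' b' =>
    unshuffle (fun c d => unshuffle (fun c' d' =>
      A a c * (B a' c' * C b' d')) d) ys) b) xs).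
  apply: eq_unshuffle => a b _; rewrite [RHS]exchange_unshuffle.
  apply: eq_unshuffle => c d _; rewrite dfmulE -unshuffleZ.
  by apply: eq_unshuffle => a' b' _; rewrite unshuffleZ.
rewrite -[LHS](unshuffle_coassoc (fun a a' b' => unshuffle (fun c d =>
  unshuffle (fun c' d' => A a c * (B a' c' * C b' d')) d) ys)).
apply: eq_unshuffle => a b _.
(* The splittings of [ys] are now regrouped in the same way, for each fixed splitting of [xs]. *)
transitivity (unshuffle (fun a0 a' => unshuffle (fun c d =>
    unshuffle (fun c' d' => A a0 c' * B a' d' * C b d) c) ys) a).
  apply: eq_unshuffle => a0 a' _.
  rewrite -[LHS](unshuffle_coassoc (fun c c' d' => A a0 c * (B a' c' * C b d'))).
  apply: eq_unshuffle => c d _.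
  by apply: eq_unshuffle => c' d' _; rewrite mulrA.
rewrite [LHS]exchange_unshuffle; apply: eq_unshuffle => c d _.
rewrite dfmulE mulrC -unshuffleZ; apply: eq_unshuffle => a0 a' _.
by rewrite -unshuffleZ; apply: eq_unshuffle => c' d' _; rewrite mulrC.
Qed.

End DoubleFormProduct.

(** * The Hodge star in an orthonormal basis *)

Section HodgeStar.
Variables (R : realType) (V : vectType R) (g : {dot V for idfun}).
Variables (n : nat) (e : n.-tuple V).
Hypothesis he : orthonormal_basis g e.
Implicit Types (A B : dform V) (I J : {set 'I_n}).

(** The Gram matrix is the identity if [I = J], and has a zero row if [I] and [J] are distinct of
    equal size; unequal sizes give 0 by definition. *)
Lemma mvcoord_pick I J : mvcoord g e I (pick_seq e J) = (I == J)%:R.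
Proof.
rewrite /mvcoord size_pick_seq.
case: (I =P J) => [<-|/eqP neqIJ].
  rewrite eqxx -[RHS](det1 _ #|I|); congr (\det _); apply/matrixP => i j.
  rewrite !mxE (nth_map (enum_val i)) -?cardE //.
  by rewrite -tnth_nth -enum_val_nth he.2 (inj_eq enum_val_inj).
case: eqP => // cardJI; have /subsetPn [i Ii J'i] : ~~ (I \subset J).
  by apply: contraNN neqIJ => sIJ; rewrite eqEcard sIJ cardJI leqnn.
(* This is the zero row: [i] lies in [I] but not in [J], so [e_i] is orthogonal to every [e_j] with
   [j] in [J]. *)
rewrite (expand_det_row _ (enum_rank_in Ii i)) big1 // => j _.
have ltjJ : (j < size (enum J))%N by rewrite -cardE cardJI.
rewrite !mxE (nth_map i) // -tnth_nth enum_rankK_in // he.2.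
case: eqP => [ij|_]; last by rewrite mul0r.
by rewrite ij -mem_enum mem_nth in J'i.
Qed.

Lemma dfstar_pick A I J :
  dfstar g e A (pick_seq e I) (pick_seq e J) =
  shuffle_sign R I * shuffle_sign R J *
    A (pick_seq e (~: I)) (pick_seq e (~: J)).
Proof.
rewrite /dfstar (bigD1 I) //= [X in _ + X]big1 => [|K neqKI]; last first.
  by rewrite big1 // => L _; rewrite mvcoord_pick (negPf neqKI) !mul0r.
rewrite addr0 (bigD1 J) //= [X in _ + X]big1 => [|L neqLJ]; last first.
  by rewrite !mvcoord_pick (negPf neqLJ) mul0r mulr0 mul0r.
by rewrite addr0 !mvcoord_pick !eqxx !mul1r.
Qed.

Lemma dfstar_nil A : dfstar g e A [::] [::] = A e e.
Proof.
have pick0 : pick_seq e (set0 : {set 'I_n}) = [::].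
  by apply: size0nil; rewrite size_pick_seq cards0.
have pickT : pick_seq e (~: set0 : {set 'I_n}) = e.
  rewrite setC0 /pick_seq /image_mem (eq_enum (in_setT (T := _))) enumT -enumT.
  rewrite (eq_map (fun i => esym (tnth_nth 0 e i))).
  by rewrite -[RHS]map_tnth_enum.
(* The sign of the empty set occurs once per argument, hence squared. *)
by rewrite -pick0 dfstar_pick pickT -expr2 sqrr_sign mul1r.
Qed.

Lemma dfdot_star A B p : double_form p p B ->
  dfdot e (dfstar g e A) B = dfmul A B e e.
Proof.
move=> [B1 B2].
have B0 b d : B b d != 0 -> size b = p /\ size d = p.
  move=> nz; split; apply/eqP; apply: contraNT nz => sz.
    by have [-> //] := B1 d.
  by have [-> //] := B2 b.
transitivity (unshuffle (fun a b => unshuffle (fun c d => A b d * B a c) e) e).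
  rewrite -(sum2_shuffle (fun a b c d => A b d * B a c) (size_tuple e)
    (size_tuple e)).
  by apply: eq_bigr => I _; apply: eq_bigr => J _; rewrite dfstar_pick mulrA.
rewrite dfmulE unshuffleC; apply: eq_unshuffle => a b sab.
rewrite unshuffleC -unshuffleZ; apply: eq_unshuffle => c d scd.
(* Swapping blocks gave the signs $(-1)^{|a||b|}$ and $(-1)^{|c||d|}$. Where [B b d] is nonzero,
   $|b|=|d|=p$ forces $|a|=|c|$, so they cancel. *)
have [->|/B0 [sb sd]] := eqVneq (B b d) 0; first by rewrite !mulr0.
have /eqP : (size a + size b = size c + size d)%N by rewrite sab scd.
by rewrite sb sd eqn_add2r => /eqP ->; rewrite mulrA -expr2 sqrr_sign mul1r.
Qed.

End HodgeStar.

Theorem theorem3p1 (R : realType) (V : vectType R) (g : {dot V for idfun})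
  (n : nat) (hn : \dim {:V} = n)
  (e : n.-tuple V) (he : orthonormal_basis g e)
  (w : dform V) (hw : double_form 2 2 w) (hsym : dfsym w)
  (hbianchi : first_bianchi w)
  (k : nat) (hk : (4 <= 2 * k + 2 <= n)%N) :
  h2k2 g e k w = dfdot e (N2k g e k w) w.
Proof.
rewrite /h2k2 /N2k (dfdot_star he _ hw) (dfstar_nil he).
(* By definition $w^{k+1}$ is $w^k w$, so associativity isolates the last factor [w]; the scalar
   then moves inside both sums. *)
rewrite [dfpow w k.+1]/= dfmulA !dfmulE -unshuffleZ.
apply: eq_unshuffle => a b _; rewrite -unshuffleZ.
by apply: eq_unshuffle => c d _; rewrite /dfscale mulrA.
Qed.
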